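(* Assume that $G\subseteq 2^\omega\times 2^\omega$ is a locally countable boldface $\mathbf{\Sigma}^1_2$ graph. Then $G$ is generated by a family $F=\{f_\alpha:\alpha<\omega_1\}$ of $\aleph_1$ boldface $\mathbf{\Delta}^1_2$ functions.
   Context: A graph is a symmetric, irreflexive relation $G\subseteq 2^\omega\times 2^\omega$; $x\mathrel G y$ means $\langle x,y\rangle\in G$. Its vertex set is $|G|=\{x:\exists y\,(x\mathrel G y)\}$. $G$ belongs to a pointclass if it does so as a set of pairs; likewise a function belongs to a pointclass if it does so as a set of pairs. $G$ is locally countable if for every $x\in|G|$ the set $\{y: x\mathrel G y\}$ is at most countable. $G$ is generated by a family $F$ of functions if each $f\in F$ is a function from some set $\operatorname{dom} f\subseteq|G|$ to $|G|$ (not necessarily with $\operatorname{dom} f=|G|$), and for all $x,y\in|G|$: $x\mathrel G y \iff \exists f\in F\,(x=f(y)\lor y=f(x))$, where an equality $y=f(x)$ means $x\in\operatorname{dom} f$ and $y=f(x)$. *)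

(* Defs.v *)
From HB Require Import structures.
From mathcomp Require Import all_boot all_order.
From mathcomp Require Import all_classical wochoice topology cantor.

Set Implicit Arguments.
Unset Strict Implicit.
Unset Printing Implicit Defensive.

Local Open Scope classical_set_scope.

(** * Boldface projective pointclasses *)

Definition baire_space : Type := prod_topology (fun _ : nat => nat).

HB.instance Definition _ := Pointed.on baire_space.
HB.instance Definition _ := Nbhs.on baire_space.
HB.instance Definition _ := Topological.on baire_space.

(* These are the usual boldface classes when X is a Polish space, such as a
   finite product of copies of cantor_space and baire_space. *)
Definition Sigma11 (X : topologicalType) (A : set X) : Prop :=
  exists C : set (X * baire_space), closed C /\ A = fst @` C.

Definition Pi11 (X : topologicalType) (A : set X) : Prop := Sigma11 (~` A).

Definition Sigma12 (X : topologicalType) (A : set X) : Prop :=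
  exists P : set (X * baire_space), Pi11 P /\ A = fst @` P.

Definition Pi12 (X : topologicalType) (A : set X) : Prop := Sigma12 (~` A).

Definition Delta12 (X : topologicalType) (A : set X) : Prop :=
  Sigma12 A /\ Pi12 A.

(** * Graphs on the Cantor space, and generating families *)

Local Notation pairs := (set (cantor_space * cantor_space)).

Definition is_graph (G : pairs) : Prop :=
  (forall x y, G (x, y) -> G (y, x)) /\ (forall x, ~ G (x, x)).

Definition vertices (G : pairs) : set cantor_space :=
  [set x | exists y, G (x, y)].

Definition locally_countable (G : pairs) : Prop :=
  forall x, vertices G x -> countable [set y | G (x, y)].

(* A (partial) function is identified with its set of pairs:
   f (x, y) means that x is in dom f and y = f(x). *)
Definition pfun_on (V : set cantor_space) (f : pairs) : Prop :=
  (forall x y z, f (x, y) -> f (x, z) -> y = z) /\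
  (forall x y, f (x, y) -> V x /\ V y).

Definition generated_by (G : pairs) (F : set pairs) : Prop :=
  (forall f, F f -> pfun_on (vertices G) f) /\
  (forall x y, vertices G x -> vertices G y ->
     (G (x, y) <-> exists2 f, F f & (f (y, x) \/ f (x, y)))).

(** * The first uncountable ordinal *)

(* omega1 consists of the points with only countably many predecessors in a
   fixed well-ordering of the (uncountable) Cantor space: by omega1P, this is
   an uncountable well-order all of whose initial segments are countable. *)
Definition cantor_wo : rel cantor_space :=
  sval (well_ordering_principle cantor_space).

Definition omega1 : Type :=
  {x : cantor_space | countable [set y | cantor_wo y x]}.

Definition omega1_le : rel omega1 := fun a b => cantor_wo (sval a) (sval b).

Lemma cantor_space_uncountable : ~ countable [set: cantor_space].
Proof.
move=> /countable_injP[f finj].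
pose d : cantor_space := fun n =>
  ~~ `[< exists2 x : cantor_space, f x = n & x n >].
have [/asboolP[x fx]|] := boolP `[< exists2 x : cantor_space, f x = f d & x (f d) >].
- have -> : x = d by apply: finj; rewrite ?inE.
  move=> dd; have := dd; rewrite {1}/d => /negP; apply.
  by apply/asboolP; exists d.
- move=> h; have dd : d (f d) by [].
  by move/negP: h; apply; apply/asboolP; exists d.
Qed.

Lemma omega1P : [/\ well_order omega1_le, ~ countable [set: omega1] &
  forall a, countable [set b | omega1_le b a]].
Proof.
have wo : well_order cantor_wo := svalP (well_ordering_principle cantor_space).
have woT : {in <= predT, well_order cantor_wo} by move=> A _; exact: wo.
have Rtot x y : cantor_wo x y || cantor_wo y x.
  by apply: (wo_chainW (C := predT) woT).
have Ranti x y : cantor_wo x y -> cantor_wo y x -> x = y.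
  by move=> xy yx; apply: (wo_chain_antisymmetric (C := predT) woT) => //; rewrite xy.
split.
- move=> A [a Aa].
  pose B : {pred cantor_space} := fun x => `[< exists2 b : omega1, b \in A & sval b = x >].
  have [|z [[/asboolP[b Ab <-] lb] _]] := wo B.
    by exists (sval a); apply/asboolP; exists a.
  have lbb : minimum_of omega1_le A b.
    by split=> // c Ac; apply: lb; apply/asboolP; exists c.
  exists b; split=> // c [Ac lbc].
  apply/eq_sig_hprop; first by move=> ? ? ?; exact: Prop_irrelevance.
  by apply: Ranti; [case: lbb => _; exact|exact: lbc].
- move=> cW.
  pose P : set cantor_space := [set x | countable [set y | cantor_wo y x]].
  have cP : countable P.
    have -> : P = range (fun a : omega1 => sval a).
      apply/seteqP; split=> [x Px|_ [a _ <-]]; last exact: (svalP a).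
      by exists (exist _ x Px).
    exact: sub_countable (card_image_le _ _) cW.
  have [PT|] := pselect (forall x, P x).
    apply: cantor_space_uncountable.
    by have <- : P = [set: cantor_space] by apply/seteqP; split.
  move=> /existsNP[x0 nPx0].
  pose B : {pred cantor_space} := fun x => ~~ `[< P x >].
  have [|m [[/negP nPm lb] _]] := wo B.
    by exists x0; apply/negP => /asboolP.
  apply: nPm; apply/asboolP.
  have : countable (P `|` [set m]).
    rewrite -bigcup2E; apply: bigcup_countable; first exact: countableP.
    by move=> [|[|]] //= *; exact: countable1.
  apply: sub_countable; apply: subset_card_le => y /= ym.
  have [Py|nPy] := pselect (P y); [by left|right].
  by apply: Ranti => //; apply: lb; apply/negP => /asboolP.
- move=> a; pose S : set omega1 := [set b | omega1_le b a].
  have : countable (sval @` S).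
    by apply: sub_countable (svalP a); apply: subset_card_le => _ [b Sb <-].
  have /eq_countable-> // : (sval @` S #= S)%card.
  apply: inj_card_eq => b c _ _ bc.
  by apply/eq_sig_hprop => // ? ? ?; exact: Prop_irrelevance.
Qed.

(* Main.v *)
Require Import Defs.
From mathcomp Require Import all_boot all_order.
From mathcomp Require Import all_classical topology cantor.
From mathcomp Require Import wochoice.

(** The theorem is proved without constructibility or uniformization: the
graph is cut into [omega1] many pieces in two elementary steps, and each piece
is even a boldface Sigma^1_1 function.

First, write [G] as the projection of a coanalytic set [P].  Membership in [P]
says that a certain tree of finite sequences of naturals, whose nodes depend
continuously on the point, has no infinite branch, hence has a rank below
[omega1].  Bounding the rank by a fixed [a] gives a set which is both analytic
and coanalytic, so [P] is a union of [omega1] many such sets, and [G] is a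
union of [omega1] many analytic sets ([Sigma12_union_omega1]).  Each of these
has countable sections, being a subset of [G].

Second, an analytic set [A] in the plane with countable sections is a union of
[omega1] many analytic partial functions ([Sigma11_countable_sections]).  Let
[A] be the projection of a closed set; for each [x] this yields a tree [T x]
whose branches are the pairs [(y, z)] with [z] witnessing [A (x, y)].  As in
the proof of the perfect set theorem, iterate the derivative that deletes the
nodes without two extensions disagreeing in their [y]-part.  If the root were
never deleted, a diagonal construction along the surviving nodes would produce
a point of the section outside any given enumeration of it
([splitting_tree_diagonal]); so the root is deleted at some countable stage.
Hence along each branch [(y, z)] there is a stage [b] whose derivative still
contains the whole branch but in which some node [t] of the branch does not
split ([deriv_covers]).  Then [y] is determined by [x], [b] and [t], and
the relation it defines is [branch_selector T b t].  All derivatives are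
both analytic and coanalytic in [x], because every stage is a countable
ordinal and there are countably many nodes.

It remains to index the functions, given by triples of two countable ordinals
and a node, by [omega1] itself ([omega1_prod_inj]), and to observe that analytic
sets are Delta^1_2 ([Sigma11_Delta12]). *)

Set Implicit Arguments.
Unset Strict Implicit.
Unset Printing Implicit Defensive.

Local Open Scope classical_set_scope.

(** * The first uncountable ordinal *)

Definition omega1_lt (a b : omega1) : Prop := omega1_le a b /\ a <> b.

Lemma omega1_le_total (a b : omega1) : omega1_le a b \/ omega1_le b a.
Proof.
have [wo _ _] := omega1P.
have := @wo_chainW {classic omega1} omega1_le predT (fun A _ => wo A).
by move=> /(_ a b isT isT)/orP.
Qed.

Lemma omega1_le_anti (a b : omega1) : omega1_le a b -> omega1_le b a -> a = b.
Proof.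
have [wo _ _] := omega1P => ab ba.
have := @wo_chain_antisymmetric {classic omega1} omega1_le predT
  (fun A _ => wo A).
by move=> /(_ a b isT isT); apply; rewrite ab.
Qed.

Lemma omega1_lt_wf : well_founded omega1_lt.
Proof.
have [wo _ _] := omega1P => a; apply: contrapT => nacc.
have [|m [[/asboolP nm lb] _]] := wo (fun a => `[< ~ Acc omega1_lt a >]).
  by exists a; apply/asboolP.
apply: nm; constructor => b [bm neq]; apply: contrapT => nb; apply: neq.
by apply: omega1_le_anti => //; apply: lb; apply/asboolP.
Qed.

Lemma omega1_lt_total (a b : omega1) :
  [\/ omega1_lt a b, a = b | omega1_lt b a].
Proof.
have [->|ab] := pselect (a = b); first by constructor 2.
case: (omega1_le_total a b) => h; first by constructor 1.
by constructor 3; split => // /esym.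
Qed.

Lemma omega1_lt_asym (a b : omega1) : omega1_lt a b -> omega1_lt b a -> False.
Proof. by move=> [ab n] [ba _]; apply: n; exact: omega1_le_anti. Qed.

Lemma omega1_lt_trans (b a c : omega1) :
  omega1_lt a b -> omega1_lt b c -> omega1_lt a c.
Proof.
move=> ab bc; have [//|ac|ca] := omega1_lt_total a c.
  by subst; case: (omega1_lt_asym ab bc).
have [wo _ _] := omega1P.
have [|m [[/asboolP[]mE lb] _]] :=
  wo (fun d => `[< [\/ d = a, d = b | d = c] >]).
- by exists a; apply/asboolP; constructor 1.
- subst m; case: (omega1_lt_asym ca); split; last by case: ca => _ /nesym.
  by apply: lb; apply/asboolP; constructor 3.
- subst m; case: (omega1_lt_asym ab); split; last by case: ab => _ /nesym.
  by apply: lb; apply/asboolP; constructor 1.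
- subst m; case: (omega1_lt_asym bc); split; last by case: bc => _ /nesym.
  by apply: lb; apply/asboolP; constructor 2.
Qed.

Lemma omega1_le_eqVlt (a b : omega1) : omega1_le a b <-> a = b \/ omega1_lt a b.
Proof.
split=> [ab|[->|[]//]]; first by have [|n] := pselect (a = b); [left|right].
by case: (omega1_le_total b b).
Qed.

Lemma countable_omega1_lt (a : omega1) : countable [set b | omega1_lt b a].
Proof.
have [_ _ ci] := omega1P; apply: sub_countable (ci a).
by apply: subset_card_le => b [].
Qed.

(** [omega1] has uncountable cofinality. *)
Lemma omega1_sup (D : set omega1) : countable D ->
  exists a, forall d, D d -> omega1_lt d a.
Proof.
have [_ unc ci] := omega1P => cD; apply: contrapT => nsup; apply: unc.
suff -> : [set: omega1] = \bigcup_(d in D) [set b | omega1_le b d].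
  by apply: bigcup_countable.
apply/seteqP; split=> // a _; apply: contrapT => na.
apply: nsup; exists a => d Dd.
have [//|da|ad] := omega1_lt_total d a; exfalso; apply: na; exists d => //=.
  by apply/omega1_le_eqVlt; left.
by case: ad.
Qed.

Lemma omega1_sup_seq (I : countType) (u : I -> omega1) :
  exists a, forall i, omega1_lt (u i) a.
Proof.
have [|a ua] := @omega1_sup (range u).
  by apply: sub_countable (card_image_le _ _) _.
by exists a => i; apply: ua; exists i.
Qed.

(** A type [S] that is an [omega1]-chain union of countable sets embeds in
[omega1]: order [S] first by [r] and then, inside each fibre of [r], by an
enumeration; this is a well-founded total order with countable initial
segments, so a strictly increasing map to [omega1] exists by recursion. *)
Lemma omega1_embedding (S : Type) (r : S -> omega1) :
  (forall a, countable [set s | omega1_le (r s) a]) ->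
  exists h : S -> omega1, injective h.
Proof.
move=> cS.
have /choice[e einj] a : exists e : S -> nat,
    forall s s', r s = a -> r s' = a -> e s = e s' -> s = s'.
  have /countable_injP[e einj] := cS a; exists e => s s' sa s'a.
  by apply: einj; rewrite inE /=; apply/omega1_le_eqVlt; left.
pose prec s' s :=
  omega1_lt (r s') (r s) \/ r s' = r s /\ e (r s) s' < e (r s) s.
have prec_wf : well_founded prec.
  suff H a : forall n s, r s = a -> e a s < n -> Acc prec s.
    by move=> s; apply: (H (r s) (e (r s) s).+1).
  have := omega1_lt_wf a; elim=> {}a _ IHa; elim=> [//|n IHn] s ra lt_en.
  constructor=> s' [lt|[rr lt]]; first by rewrite ra in lt; apply: (IHa _ lt).
  by rewrite ra in rr lt; apply: IHn => //; apply: leq_trans lt _.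
have prec_total s s' : [\/ prec s s', s = s' | prec s' s].
  have [lt|rr|lt] := omega1_lt_total (r s) (r s').
  - by constructor 1; left.
  - have [lt|gt|ee] := ltngtP (e (r s) s) (e (r s) s').
    + by constructor 1; right; rewrite -rr.
    + by constructor 3; right; rewrite -rr.
    + by constructor 2; apply: einj ee; rewrite -?rr.
  - by constructor 3; left.
have prec_count s : countable [set s' | prec s' s].
  apply: sub_countable (cS (r s)); apply: subset_card_le => s' [[]//|[rr _] /=].
  by apply/omega1_le_eqVlt; left.
have sup_ex s (g : forall s', prec s' s -> omega1) :
    exists a, forall s' (p : prec s' s), omega1_lt (g s' p) a.
  have [|a ag] := @omega1_sup [set b | exists s' (p : prec s' s), b = g s' p].
    have -> : [set b | exists s' (p : prec s' s), b = g s' p] =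
      \bigcup_(s' in [set s' | prec s' s])
        [set b | exists p : prec s' s, b = g s' p].
      by apply/seteqP; split=> [b [s' [p ->]]|b [s' _ [p ->]]];
        exists s' => //; exists p.
    apply: bigcup_countable => // s' p.
    apply: (sub_countable _ (countable1 (g s' p))).
    by apply: subset_card_le => b [q ->] /=; congr g; exact: Prop_irrelevance.
  by exists a => s' p; apply: ag; exists s', p.
(* h s is a strict upper bound of the earlier values. *)
pose h := Fix prec_wf (fun=> omega1) (fun s g => projT1 (cid (sup_ex s g))).
have hlt s s' : prec s' s -> omega1_lt (h s') (h s).
  move=> p; rewrite /h [X in omega1_lt _ X]Fix_eq.
    by case: cid => a /= /(_ s' p).
  move=> x f g fg; suff -> : f = g by [].
  by apply: functional_extensionality_dep => y;
    apply: functional_extensionality_dep.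
exists h => s s' hE.
by have [/hlt|//|/hlt] := prec_total s s'; rewrite hE => -[].
Qed.

Lemma omega1_prod_inj (I : countType) :
  exists h : omega1 * omega1 * I -> omega1, injective h.
Proof.
have /choice[m mP] (s : omega1 * omega1 * I) : exists a,
    omega1_lt s.1.1 a /\ omega1_lt s.1.2 a.
  have [a aP] := omega1_sup_seq (fun b : bool => if b then s.1.1 else s.1.2).
  by exists a; split; [apply: (aP true)|apply: (aP false)].
apply: (@omega1_embedding _ m) => a.
have : countable
    ([set b | omega1_lt b a] `*` [set b | omega1_lt b a] `*` [set: I]).
  by do 2?apply: countableX; rewrite //; apply: countable_omega1_lt.
apply: sub_countable; apply: subset_card_le => -[[b c] i] /omega1_le_eqVlt h.
have [/= lb lc] := mP (b, c, i); split=> //=; split => /=.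
  by case: h => [<-//|]; apply: omega1_lt_trans.
by case: h => [<-//|]; apply: omega1_lt_trans.
Qed.

(** * Countable bases of clopen sets *)

(** Initial segments form a base of neighbourhoods in a countable power of a
discrete space. *)
Lemma nbhs_prod_seq (K : discreteTopologicalType)
    (x : prod_topology (fun _ : nat => K))
    (U : set (prod_topology (fun _ : nat => K))) :
  nbhs x U <-> exists n, [set y | mkseq y n = mkseq x n] `<=` U.
Proof.
have FN : Filter (nbhs x) by exact: nbhs_filter.
split=> [xU|[n nU]].
  pose F := filter_from [set: nat] (fun n =>
    [set y : prod_topology (fun _ : nat => K) | mkseq y n = mkseq x n]).
  have FF : Filter F.
    apply: filter_from_filter; first by exists 0.
    move=> m n _ _; exists (maxn m n) => // y /= /(congr1 (nth (x 0) ^~ _)) xy.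
    split; apply: (@eq_from_nth _ (x 0)); rewrite ?size_mkseq // => i lt_in;
      have := xy i; rewrite !nth_mkseq // ?leq_max ?lt_in ?orbT //; exact.
  suff /(_ U xU) : F --> x by case=> n _ nU; exists n.
  apply/cvg_sup => i V [/= _ [[W oW <-] Wx WV]].
  exists i.+1 => // y /= /(congr1 (nth (x 0) ^~ i));
    rewrite !nth_mkseq // => yx.
  by apply: WV; rewrite /= yx.
apply: (filterS nU).
elim: n {nU} => [|n IHn]; first exact: filterE.
have : nbhs x [set y : prod_topology (fun _ : nat => K) | y n = x n].
  have /= := @proj_continuous _ (fun _ : nat => K : topologicalType) n x.
  move=> /(_ [set x n]); apply; rewrite /proj.
  by rewrite nbhs_principalE; apply/principal_filterP.
move=> h; apply: filterS2 IHn h => y /= e1 e2.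
by rewrite !mkseqS e1 e2.
Qed.

(** [e] encodes a countable base of clopen sets: the basic neighbourhoods of
[x] are the sets of all [y] with [e n y = e n x], and they decrease with [n].
Such an [e] exists on every zero-dimensional Polish space; it is used for the
Cantor space, the Baire space and their finite products. *)
Definition clopen_codes (X : topologicalType) (e : nat -> X -> nat) : Prop :=
  [/\ forall n x, nbhs x [set y | e n y = e n x],
      forall x U, nbhs x U -> exists n, [set y | e n y = e n x] `<=` U &
      forall m n x y, m <= n -> e n y = e n x -> e m y = e m x].

Lemma clopen_codes_seq (K : discreteTopologicalType) (c : K -> nat) :
  injective c ->
  @clopen_codes (prod_topology (fun _ : nat => K))
    (fun n x => pickle (mkseq (c \o x) n)).
Proof.
move=> cinj.
have mE n (x y : nat -> K) :
    pickle (mkseq (c \o y) n) = pickle (mkseq (c \o x) n) ->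
    mkseq y n = mkseq x n.
  move=> /(pcan_inj pickleK).
  rewrite /mkseq (map_comp c y) (map_comp c x).
  exact: (inj_map cinj).
split.
- move=> n x; apply/nbhs_prod_seq; exists n => y /=.
  by rewrite /mkseq (map_comp c y) (map_comp c x) => ->.
- by move=> x U /nbhs_prod_seq[n nU]; exists n => y /mE; exact: nU.
- move=> m n x y lt_mn /mE/(congr1 (take m)).
  rewrite /mkseq -!map_take !take_iota (minn_idPl lt_mn) => xy.
  by rewrite (map_comp c y) (map_comp c x) xy.
Qed.

Lemma clopen_codes_prod (X Y : topologicalType) eX eY :
  @clopen_codes X eX -> @clopen_codes Y eY ->
  @clopen_codes (X * Y)%type (fun n p => pickle (eX n p.1, eY n p.2)).
Proof.
move=> [nX bX mX] [nY bY mY]; split.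
- move=> n [x y].
  exists ([set x' | eX n x' = eX n x], [set y' | eY n y' = eY n y]).
    by split; [exact: nX|exact: nY].
  by move=> [x' y'] [/= -> ->].
- move=> [x y] U [[A B] [/= /bX[m mA] /bY[n nB]] AB].
  exists (maxn m n) => -[x' y'] /=.
  move=> /(pcan_inj pickleK)[e1 e2]; apply: AB; split => /=.
    by apply: mA; apply: mX e1; rewrite leq_maxl.
  by apply: nB; apply: mY e2; rewrite leq_maxr.
- move=> m n [x y] [x' y'] le_mn /= /(pcan_inj pickleK)[e1 e2].
  by rewrite (mX _ _ _ _ le_mn e1) (mY _ _ _ _ le_mn e2).
Qed.

(** The codes are those of the initial segments of length [n]. *)
Definition seq_code n (x : baire_space) : nat := pickle (mkseq x n).

Lemma clopen_codes_baire : clopen_codes seq_code.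
Proof. exact: (@clopen_codes_seq nat id). Qed.

Definition cantor_code (n : nat) (x : cantor_space) : nat :=
  pickle (mkseq (nat_of_bool \o x) n).

Lemma clopen_codes_cantor : clopen_codes cantor_code.
Proof. by apply: (@clopen_codes_seq bool nat_of_bool) => -[] []. Qed.

Section ClopenCodes.
Variables (X : topologicalType) (e : nat -> X -> nat).
Hypothesis eX : clopen_codes e.

Lemma saturated_open n (A : set X) :
  (forall x y, e n y = e n x -> A x -> A y) -> open A.
Proof.
move=> satA; rewrite openE => x Ax; have [nX _ _] := eX.
by apply: filterS (nX n x) => y /satA; apply.
Qed.

Lemma saturated_closed n (A : set X) :
  (forall x y, e n y = e n x -> A x -> A y) -> closed A.
Proof.
move=> satA; rewrite -openC; apply: (@saturated_open n) => x y yx nAx Ay.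
by apply: nAx; apply: satA Ay.
Qed.

Lemma closed_codesP (A : set X) x :
  closed A -> (forall n, exists2 y, A y & e n y = e n x) -> A x.
Proof.
rewrite -openC openE => oA Ax; apply: contrapT => nAx.
have [_ bX _] := eX; have /bX[n nA] := oA x nAx.
by have [y Ay yx] := Ax n; apply: (nA y).
Qed.

Lemma continuous_codesP (Y : topologicalType) (f : Y -> X) :
  (forall n y, nbhs y [set z | e n (f z) = e n (f y)]) -> continuous f.
Proof.
move=> fe y U fyU; have [_ bX _] := eX; have [n nU] := bX _ _ fyU.
by apply: filterS (fe n y) => z /= /nU.
Qed.

End ClopenCodes.

(** * Analytic sets *)

Lemma nbhs_coord (z : baire_space) i : nbhs z [set y : baire_space | y i = z i].
Proof.
apply/nbhs_prod_seq; exists i.+1 => y /= /(congr1 (nth 0 ^~ i)).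
by rewrite !nth_mkseq.
Qed.

Lemma continuous_baireP (Y : topologicalType) (f : Y -> baire_space) :
  (forall i y, nbhs y [set z | f z i = f y i]) -> continuous f.
Proof.
move=> fcont; apply: (continuous_codesP clopen_codes_baire) => n y.
suff : nbhs y [set z | mkseq (f z) n = mkseq (f y) n].
  by apply: filterS => z /= e; rewrite /seq_code e.
elim: n => [|n IHn]; first exact: filterE.
by apply: filterS2 IHn (fcont n y) => z /= e1 e2; rewrite !mkseqS e1 e2.
Qed.

Lemma continuous_pairing (X Y Z : topologicalType) (f : X -> Y) (g : X -> Z) :
  continuous f -> continuous g -> continuous (fun x => (f x, g x)).
Proof. by move=> fc gc x; apply: cvg_pair; [exact: fc|exact: gc]. Qed.

Lemma continuous_fst (X Y : topologicalType) : continuous (@fst X Y).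
Proof. by move=> p; exact: cvg_fst. Qed.

Lemma continuous_snd (X Y : topologicalType) : continuous (@snd X Y).
Proof. by move=> p; exact: cvg_snd. Qed.

Lemma continuous_compose (X Y Z : topologicalType) (f : Y -> Z) (g : X -> Y) :
  continuous f -> continuous g -> continuous (fun x => f (g x)).
Proof. by move=> fc gc x; apply: continuous_comp; [exact: gc|exact: fc]. Qed.

(** A point of the Baire space codes a sequence of points: [slice n z] is the
[n]-th one. *)
Definition slice (n : nat) (z : baire_space) : baire_space :=
  fun i => z (pickle (n, i)).

(** Codes are pairs of naturals; the default 0 is never read by [slice]. *)
Definition unslice (w : nat -> baire_space) : baire_space :=
  fun k => if @unpickle (nat * nat)%type k is Some ni then w ni.1 ni.2 else 0.

Lemma unsliceK w n : slice n (unslice w) = w n.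
Proof. by apply/funext => i; rewrite /slice /unslice pickleK. Qed.

Lemma continuous_slice n : continuous (slice n).
Proof. by apply: continuous_baireP => i y; exact: nbhs_coord. Qed.

Section Sigma11.
Variable X : topologicalType.
Implicit Types A : set X.

Lemma closed_Sigma11 A : closed A -> Sigma11 A.
Proof.
move=> cA; exists (fst @^-1` A); split.
  by have /continuous_closedP := @continuous_fst X baire_space; apply.
apply/seteqP; split=> [x Ax|_ [[x z] Ax <-]//].
by exists (x, fun=> 0).
Qed.

Lemma Sigma11_preimage (Y : topologicalType) (f : Y -> X) A :
  continuous f -> Sigma11 A -> Sigma11 (f @^-1` A).
Proof.
move=> fc [C [cC ->]]; exists [set p | C (f p.1, p.2)]; split.
  have /continuous_closedP h :
      continuous (fun p : Y * baire_space => (f p.1, p.2)).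
    apply: continuous_pairing; last exact: continuous_snd.
    by apply: continuous_compose fc _; exact: continuous_fst.
  exact: h.
apply/seteqP; split=> [y [[x z] Cxz /= xy]|y [[y' z] /= Cyz <-]].
  by exists (y, z) => //=; rewrite -xy.
by exists (f y', z).
Qed.

Lemma Sigma11_bigcap_nat (F : nat -> set X) :
  (forall n, Sigma11 (F n)) -> Sigma11 (\bigcap_n F n).
Proof.
move=> /choice[C CF]; exists (\bigcap_n [set p | C n (p.1, slice n p.2)]).
split.
  apply: closed_bigI => n _; have [cC _] := CF n.
  have /continuous_closedP h :
      continuous (fun p : X * baire_space => (p.1, slice n p.2)).
    apply: continuous_pairing; first exact: continuous_fst.
    by apply: continuous_compose (@continuous_slice n) _; exact: continuous_snd.
  exact: h.
apply/seteqP; split=> [x Fx|x [[x' z] /= Cxz <-] n _]; last first.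
  by have [_ ->] := CF n; exists (x', slice n z) => //; exact: Cxz.
have /choice[w wP] n : exists z, C n (x, z).
  by have := Fx n I; have [_ ->] := CF n => -[[x' z] Cz /= <-]; exists z.
by exists (x, unslice w) => // n _ /=; rewrite unsliceK.
Qed.

Lemma Sigma11_bigcup_nat (F : nat -> set X) :
  (forall n, Sigma11 (F n)) -> Sigma11 (\bigcup_n F n).
Proof.
move=> /choice[C CF].
(* slice 0 names the index by its first value, slice 1 is the witness *)
exists (\bigcap_n [set p | p.2 (pickle (0, 0)) = n -> C n (p.1, slice 1 p.2)]).
split.
  apply: closed_bigI => n _; have [cC _] := CF n.
  have -> : [set p : X * baire_space |
       p.2 (pickle (0, 0)) = n -> C n (p.1, slice 1 p.2)] =
     (snd @^-1` [set z : baire_space | z (pickle (0, 0)) <> n]) `|`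
     [set p | C n (p.1, slice 1 p.2)].
    apply/seteqP; split=> p; last by case=> [nz /nz []|h _].
    move=> /= h; have [e|ne] := pselect (p.2 (pickle (0, 0)) = n); last by left.
    by right; exact: h.
  apply: closedU.
    have /continuous_closedP h := @continuous_snd X baire_space; apply: h.
    apply: (@saturated_closed _ _ clopen_codes_baire (pickle (0, 0)).+1) => x y.
    move=> /(pcan_inj pickleK) /(congr1 (nth 0 ^~ (pickle (0, 0)))).
    by rewrite !nth_mkseq //= => ->.
  have /continuous_closedP h :
      continuous (fun p : X * baire_space => (p.1, slice 1 p.2)).
    apply: continuous_pairing; first exact: continuous_fst.
    by apply: continuous_compose (@continuous_slice 1) _; exact: continuous_snd.
  exact: h.
apply/seteqP; split=> [x [n _]|x [[x' z] /= Cz <-]].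
  have [_ ->] := CF n => -[[x' z] Cz /= <-].
  pose w := unslice (fun k => if k == 1 then z else (fun=> n)).
  exists (x', w) => // m _ /=.
  rewrite /w unsliceK /= => <-.
  by rewrite [unslice _ _](congr1 (@^~ 0) (unsliceK _ 0)).
exists (z (pickle (0, 0))) => //; have [_ ->] := CF (z (pickle (0, 0))).
by exists (x', slice 1 z) => //; exact: Cz.
Qed.

Lemma Sigma11_set0 : Sigma11 (@set0 X).
Proof. by apply: closed_Sigma11; exact: closed0. Qed.

Lemma Sigma11_setT : Sigma11 [set: X].
Proof. by apply: closed_Sigma11; exact: closedT. Qed.

Lemma Sigma11_bigcup (I : Type) (D : set I) (F : I -> set X) :
  countable D -> (forall i, D i -> Sigma11 (F i)) ->
  Sigma11 (\bigcup_(i in D) F i).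
Proof.
move=> /countable_injP[c cinj] FS.
have -> : \bigcup_(i in D) F i =
    \bigcup_n \bigcup_(i in D `&` [set i | c i = n]) F i.
  apply/seteqP; split=> [x [i Di Fi]|x [n _ [i [Di _] Fi]]]; last by exists i.
  by exists (c i) => //; exists i.
apply: Sigma11_bigcup_nat => n.
have [[i [Di ci]]|no] := pselect (exists i, D i /\ c i = n).
  suff -> : D `&` [set i | c i = n] = [set i] by rewrite bigcup_set1; exact: FS.
  apply/seteqP; split=> [j [Dj cj]|_ ->//]; apply: cinj; rewrite ?inE //.
  by rewrite ci.
suff -> : D `&` [set i | c i = n] = set0.
  by rewrite bigcup_set0; exact: Sigma11_set0.
by apply/seteqP; split=> // i [Di ci]; apply: no; exists i.
Qed.

Lemma Sigma11_bigcap (I : Type) (D : set I) (F : I -> set X) :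
  countable D -> (forall i, D i -> Sigma11 (F i)) ->
  Sigma11 (\bigcap_(i in D) F i).
Proof.
move=> /countable_injP[c cinj] FS.
have -> : \bigcap_(i in D) F i =
    \bigcap_n \bigcap_(i in D `&` [set i | c i = n]) F i.
  apply/seteqP; split=> [x Fx n _ i [Di _]|x Fx i Di]; first exact: Fx.
  by apply: (Fx (c i)).
apply: Sigma11_bigcap_nat => n.
have [[i [Di ci]]|no] := pselect (exists i, D i /\ c i = n).
  suff -> : D `&` [set i | c i = n] = [set i] by rewrite bigcap_set1; exact: FS.
  apply/seteqP; split=> [j [Dj cj]|_ ->//]; apply: cinj; rewrite ?inE //.
  by rewrite ci.
suff -> : D `&` [set i | c i = n] = set0.
  by rewrite bigcap_set0; exact: Sigma11_setT.
by apply/seteqP; split=> // i [Di ci]; apply: no; exists i.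
Qed.

Lemma Sigma11_setI A B : Sigma11 A -> Sigma11 B -> Sigma11 (A `&` B).
Proof.
move=> SA SB.
have -> : A `&` B = \bigcap_(b in [set: bool]) (if b then A else B).
  by apply/seteqP; split=> [x [Ax Bx] [] //|x AB]; split;
    [exact: (AB true)|exact: (AB false)].
by apply: Sigma11_bigcap => // -[].
Qed.

Lemma Sigma11_proj (A : set (X * baire_space)) :
  Sigma11 A -> Sigma11 (fst @` A).
Proof.
move=> [C [cC ->]]; exists [set p | C ((p.1, slice 0 p.2), slice 1 p.2)]; split.
  have /continuous_closedP h : continuous
      (fun p : X * baire_space => ((p.1, slice 0 p.2), slice 1 p.2)).
    have sc n : continuous (fun p : X * baire_space => slice n p.2).
      by apply: continuous_compose (@continuous_slice n) _;
        exact: continuous_snd.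
    apply: continuous_pairing => //; apply: continuous_pairing => //.
    exact: continuous_fst.
  exact: h.
apply/seteqP; split=> [_ [_ [[[x y] z] Cxyz <-] <-]|_ [[x w] /= Cxw <-]].
  by exists (x, unslice (fun k => if k == 0 then y else z)) => //=;
    rewrite !unsliceK.
by exists (x, slice 0 w) => //; exists ((x, slice 0 w), slice 1 w).
Qed.

End Sigma11.

(** The sets that are both analytic and coanalytic. *)
Definition Delta11 (X : topologicalType) (A : set X) : Prop :=
  Sigma11 A /\ Pi11 A.

Section Delta11.
Variable X : topologicalType.
Implicit Types A : set X.

Lemma Delta11_setC A : Delta11 A -> Delta11 (~` A).
Proof. by move=> [SA PA]; split; rewrite /Pi11 ?setCK. Qed.

Lemma Delta11_bigcup (I : Type) (D : set I) (F : I -> set X) :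
  countable D -> (forall i, D i -> Delta11 (F i)) ->
  Delta11 (\bigcup_(i in D) F i).
Proof.
move=> cD FD; split; first by apply: Sigma11_bigcup => // i /FD[].
by rewrite /Pi11 setC_bigcup; apply: Sigma11_bigcap => // i /FD[].
Qed.

Lemma Delta11_bigcap (I : Type) (D : set I) (F : I -> set X) :
  countable D -> (forall i, D i -> Delta11 (F i)) ->
  Delta11 (\bigcap_(i in D) F i).
Proof.
move=> cD FD; split; first by apply: Sigma11_bigcap => // i /FD[].
by rewrite /Pi11 setC_bigcap; apply: Sigma11_bigcup => // i /FD[].
Qed.

Lemma Delta11_cst (P : Prop) : Delta11 [set x : X | P].
Proof.
have [p|np] := pselect P.
  have -> : [set x : X | P] = setT by apply/seteqP; split.
  split; first exact: Sigma11_setT.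
  by rewrite /Pi11 setCT; exact: Sigma11_set0.
have -> : [set x : X | P] = set0 by apply/seteqP; split.
split; first exact: Sigma11_set0.
by rewrite /Pi11 setC0; exact: Sigma11_setT.
Qed.

Lemma Delta11_setI A B : Delta11 A -> Delta11 B -> Delta11 (A `&` B).
Proof.
move=> DA DB.
have -> : A `&` B = \bigcap_(b in [set: bool]) (if b then A else B).
  by apply/seteqP; split=> [x [Ax Bx] [] //|x AB]; split;
    [exact: (AB true)|exact: (AB false)].
by apply: Delta11_bigcap => // -[].
Qed.

Lemma Delta11_preimage (Y : topologicalType) (f : Y -> X) A :
  continuous f -> Delta11 A -> Delta11 (f @^-1` A).
Proof.
move=> fc [SA PA]; split; first exact: Sigma11_preimage.
by rewrite /Pi11 preimage_setC; exact: Sigma11_preimage.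
Qed.

Lemma saturated_Delta11 e n A : @clopen_codes X e ->
  (forall x y, e n y = e n x -> A x -> A y) -> Delta11 A.
Proof.
move=> eX satA; split; apply: closed_Sigma11.
  exact: (saturated_closed eX satA).
apply: (saturated_closed eX (n := n)) => x y yx nAx Ay; apply: nAx.
by apply: satA Ay.
Qed.

Lemma open_Sigma11 e A : @clopen_codes X e -> open A -> Sigma11 A.
Proof.
move=> eX oA.
have -> : A = \bigcup_(nk in [set: nat * nat])
    [set x | e nk.1 x = nk.2 /\ [set y | e nk.1 y = nk.2] `<=` A].
  apply/seteqP; split=> [x Ax|x [nk _ [xk]]]; last exact.
  have [_ bX _] := eX; have /bX[n nA] : nbhs x A by apply: open_nbhs_nbhs.
  by exists (n, e n x).
apply: Sigma11_bigcup => // -[n k] _.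
have [] // : Delta11 [set x | e n x = k /\ [set y | e n y = k] `<=` A].
by apply: (@saturated_Delta11 _ n _ eX) => x y /= ->.
Qed.

End Delta11.

(** Only the inclusion in Sigma12 needs the clopen base: closed sets must be
coanalytic. *)
Lemma Sigma11_Delta12 (X : topologicalType) e (A : set X) :
  @clopen_codes X e -> Sigma11 A -> Delta12 A.
Proof.
move=> eX SA; split.
  have [C [cC ->]] := SA; exists C; split => //; rewrite /Pi11.
  apply: (open_Sigma11 (clopen_codes_prod eX clopen_codes_baire)).
  by rewrite openC.
exists (fst @^-1` (~` A)); split.
  rewrite /Pi11 preimage_setC setCK.
  by apply: Sigma11_preimage SA; exact: continuous_fst.
apply/seteqP; split=> [x Ax|_ [[x z] Ax <-]//].
by exists (x, fun=> 0).
Qed.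

(** * Sigma^1_2 sets as unions of analytic sets *)

(** [tree_rank T a s]: the tree of proper extensions of [s] in [T] is
well-founded, of rank at most [a]. *)
Inductive tree_rank (T : seq nat -> Prop) (a : omega1) (s : seq nat) : Prop :=
  TreeRank : (forall k, T (rcons s k) ->
    exists b, omega1_lt b a /\ tree_rank T b (rcons s k)) -> tree_rank T a s.

Lemma tree_rankE T a s : tree_rank T a s <->
  forall k, T (rcons s k) ->
    exists2 b, omega1_lt b a & tree_rank T b (rcons s k).
Proof.
split; first by case=> h k /h[b [ba r]]; exists b.
by move=> h; constructor=> k /h[b ba r]; exists b.
Qed.

Lemma tree_rank_nobranch T a (z : nat -> nat) n :
  tree_rank T a (mkseq z n) -> (forall m, T (mkseq z m)) -> False.
Proof.
move=> + Tz; have := omega1_lt_wf a; move=> acc; elim: acc n => {}a _ IH n.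
move=> /tree_rankE/(_ (z n)); rewrite -mkseqS => /(_ (Tz _))[b ba]; exact: IH.
Qed.

(** Ranks of the children of a node have a bound in [omega1], so an unranked
node has an unranked child, and following such children gives a branch. *)
Lemma tree_rank_exists T : (forall z, ~ forall m, T (mkseq z m)) -> T [::] ->
  exists a, tree_rank T a [::].
Proof.
move=> noz T0; apply: contrapT => bad0.
have bad_step s : ~ (exists a, tree_rank T a s) ->
    exists k, T (rcons s k) /\ ~ (exists a, tree_rank T a (rcons s k)).
  move=> bad; apply: contrapT => nk; apply: bad.
  have /choice[u uP] k : exists a, T (rcons s k) -> tree_rank T a (rcons s k).
    have [Tk|nT] := pselect (T (rcons s k)).
      have [[a ra]|nr] := pselect (exists a, tree_rank T a (rcons s k));
        first by exists a.
      by case: nk; exists k.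
    have [a _] := omega1_sup (@countable0 omega1); by exists a.
  have [a ua] := omega1_sup_seq u; exists a; apply/tree_rankE => k Tk.
  by exists (u k); [exact: ua|exact: uP].
have /choice[k kP] s : exists k, ~ (exists a, tree_rank T a s) ->
    T (rcons s k) /\ ~ (exists a, tree_rank T a (rcons s k)).
  have [g|/bad_step[k h]] := pselect (exists a, tree_rank T a s);
    first by exists 0.
  by exists k.
pose S n := iter n (fun s => rcons s (k s)) [::].
pose z n := k (S n).
have Sz n : S n = mkseq z n by elim: n => [//|n IHn]; rewrite mkseqS -IHn.
have badS n : T (S n) /\ ~ (exists a, tree_rank T a (S n)).
  by elim: n => [//|n [_ /kP]].
by apply: (noz z) => m; rewrite -Sz; case: (badS m).
Qed.

Lemma Delta11_tree_rank (X : topologicalType) (T : X -> seq nat -> Prop) :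
  (forall s, Delta11 [set x | T x s]) ->
  forall a s, Delta11 [set x | tree_rank (T x) a s].
Proof.
move=> TD a; have := omega1_lt_wf a; elim=> {}a _ IH s.
have -> : [set x | tree_rank (T x) a s] = \bigcap_(k in [set: nat])
    ~` ([set x | T x (rcons s k)] `&`
        ~` \bigcup_(b in [set b | omega1_lt b a])
          [set x | tree_rank (T x) b (rcons s k)]).
  apply/seteqP; split=> x.
    by move=> /tree_rankE h k _ [/h[b ba r]]; apply; exists b.
  move=> h; apply/tree_rankE => k Tk; apply: contrapT => nb; apply: (h k I).
  by split=> // -[b ba r]; apply: nb; exists b.
apply: Delta11_bigcap => // k _; apply: Delta11_setC; apply: Delta11_setI => //.
apply: Delta11_setC; apply: Delta11_bigcup; first exact: countable_omega1_lt.
by move=> b ba; apply: IH.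
Qed.

(** The pieces collect the points whose tree has rank at most [a]; they are the
classical constituents of [P]. *)
Lemma Pi11_union_omega1 (X : topologicalType) (e : nat -> X -> nat)
    (P : set X) :
  clopen_codes e -> Pi11 P ->
  exists A : omega1 -> set X, (forall a, Delta11 (A a)) /\ P = \bigcup_a A a.
Proof.
move=> eX [C [cC PC]].
(* Closeness to x is only asked up to the length of s, so that membership of
s in the tree is a clopen condition on x. *)
pose T x s := exists y z, [/\ C (y, z), e (size s) y = e (size s) x &
  mkseq z (size s) = s].
have TD s : Delta11 [set x | T x s].
  apply: (saturated_Delta11 (n := size s) eX) => x y yx [x' [z [Cx ex zs]]].
  by exists x', z; split => //; rewrite ex yx.
have TC x z : (forall m, T x (mkseq z m)) <-> C (x, z).
  split=> [Txz|Cxz m]; last by exists x, z; rewrite size_mkseq.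
  apply: (closed_codesP (clopen_codes_prod eX clopen_codes_baire) cC) => n.
  have [x' [z' [Cx ex ez]]] := Txz n; rewrite size_mkseq in ex ez.
  by exists (x', z') => //=; rewrite ex /seq_code ez.
(* The rank only looks at proper extensions of the root, so the case of an
empty tree is added separately. *)
exists (fun a => [set x | ~ T x [::]] `|` [set x | tree_rank (T x) a [::]]).
split.
  move=> a; rewrite -[_ `|` _]setCK setCU; apply: Delta11_setC.
  apply: Delta11_setI; apply: Delta11_setC; last exact: Delta11_tree_rank.
  exact: (Delta11_setC (TD _)).
have nP x : P x <-> forall z, ~ C (x, z).
  split=> [Px z Cz|nz].
    by have : (~` P) x by rewrite PC; exists (x, z).
  apply: contrapT => nPx; have : (~` P) x by [].
  by rewrite PC => -[[x' z] /= Cz xx]; subst; apply: (nz z).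
apply/seteqP; split=> x.
  move=> /nP nz; have [T0|nT0] := pselect (T x [::]).
    have [a ra] := tree_rank_exists (fun z Tz => nz z (proj1 (TC x z) Tz)) T0.
    by exists a => //; right.
  have [a _] := omega1_sup (@countable0 omega1).
  by exists a => //; left.
move=> [a _ h]; apply/nP => z /TC Txz; case: h => [|r]; first by have := Txz 0.
exact: (@tree_rank_nobranch _ _ z 0 r).
Qed.

Lemma Sigma12_union_omega1 (X : topologicalType) (e : nat -> X -> nat)
    (A : set X) :
  clopen_codes e -> Sigma12 A ->
  exists B : omega1 -> set X, (forall a, Sigma11 (B a)) /\ A = \bigcup_a B a.
Proof.
move=> eX [P [PP ->]].
have [B [BD ->]] :=
  Pi11_union_omega1 (clopen_codes_prod eX clopen_codes_baire) PP.
exists (fun a => fst @` B a); split; last by rewrite image_bigcup.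
by move=> a; apply: Sigma11_proj; case: (BD a).
Qed.

(** * Derivatives of trees *)

(** A node approximates a pair of a point of the Cantor space and a point of
the Baire space. *)
Local Notation node := (seq (bool * nat)).

(** The first [n] terms of the branch [(y, z)]. *)
Definition restr (y : cantor_space) (z : baire_space) (n : nat) : node :=
  mkseq (fun i => (y i, z i)) n.

(** The two nodes disagree in their first components; differences between the
witnesses do not count. *)
Definition incompatible (u v : node) : Prop :=
  exists i, [/\ i < size u, i < size v &
    (nth (false, 0) u i).1 <> (nth (false, 0) v i).1].

(** [deriv T a] is the [a]-th derivative of the tree [T]: a node survives stage
[a] when at each earlier stage it had two surviving incompatible extensions.
Predecessors and limits need no separate treatment. *)
Inductive deriv (T : node -> Prop) (a : omega1) (t : node) : Prop :=
  Deriv : T t ->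
  (forall b, omega1_lt b a -> exists u v,
    [/\ deriv T b (t ++ u), deriv T b (t ++ v) &
      incompatible (t ++ u) (t ++ v)]) ->
  deriv T a t.

(** The node [t] has two incompatible extensions in [D]. *)
Definition splits (D : node -> Prop) (t : node) : Prop :=
  exists uv : node * node,
    [/\ D (t ++ uv.1), D (t ++ uv.2) & incompatible (t ++ uv.1) (t ++ uv.2)].

Lemma derivE T a t : deriv T a t <->
  T t /\ forall b, omega1_lt b a -> splits (deriv T b) t.
Proof.
split; first by case=> Tt h; split=> // b /h[u [v p]]; exists (u, v).
by move=> [Tt h]; constructor=> // b /h[[u v] p]; exists u, v.
Qed.

Lemma deriv_decr T a b t : omega1_lt a b -> deriv T b t -> deriv T a t.
Proof.
move=> ab /derivE[Tt h]; apply/derivE; split=> // c ca; apply: h.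
exact: omega1_lt_trans ab.
Qed.

(** Nodes that are never deleted split into nodes that are never deleted:
otherwise all pairs of extensions would have failed by some common stage. *)
Lemma deriv_kernel_splits T t : (forall a, deriv T a t) ->
  splits (fun u => forall a, deriv T a u) t.
Proof.
move=> Kt; apply: contrapT => nsplit.
have /choice[u uP] (uv : node * node) : exists a,
    ~ [/\ deriv T a (t ++ uv.1), deriv T a (t ++ uv.2) &
      incompatible (t ++ uv.1) (t ++ uv.2)].
  apply: contrapT => na; apply: nsplit; exists uv.
  have H a : [/\ deriv T a (t ++ uv.1), deriv T a (t ++ uv.2) &
      incompatible (t ++ uv.1) (t ++ uv.2)].
    by apply: contrapT => n; apply: na; exists a.
  have [a0 _] := omega1_sup (@countable0 omega1).
  by split=> [a|a|]; [case: (H a)|case: (H a)|case: (H a0)].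
have [a ua] := omega1_sup_seq u.
have [a' aa'] := omega1_sup (countable1 a).
have /derivE[_ /(_ a (aa' a erefl))[uv [D1 D2 s]]] := Kt a'.
by apply: (uP uv); split=> //; apply: deriv_decr (ua uv) _.
Qed.

Lemma Delta11_splits (X : topologicalType) (D : X -> node -> Prop) t :
  (forall t, Delta11 [set x | D x t]) -> Delta11 [set x | splits (D x) t].
Proof.
move=> DD.
have -> : [set x | splits (D x) t] = \bigcup_(uv in [set: node * node])
    ([set x | D x (t ++ uv.1)] `&` ([set x | D x (t ++ uv.2)] `&`
     [set x | incompatible (t ++ uv.1) (t ++ uv.2)])).
  by apply/seteqP; split=> [x [uv [? ? ?]]|x [uv _ [? [? ?]]]]; exists uv.
apply: Delta11_bigcup => // uv _; do 2!apply: Delta11_setI => //.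
exact: Delta11_cst.
Qed.

Lemma Delta11_deriv (X : topologicalType) (T : X -> node -> Prop) :
  (forall t, Delta11 [set x | T x t]) ->
  forall a t, Delta11 [set x | deriv (T x) a t].
Proof.
move=> TD a; have := omega1_lt_wf a; elim=> {}a _ IH t.
have -> : [set x | deriv (T x) a t] = [set x | T x t] `&`
    \bigcap_(b in [set b | omega1_lt b a]) [set x | splits (deriv (T x) b) t].
  by apply/seteqP; split=> x /derivE.
apply: Delta11_setI => //; apply: Delta11_bigcap;
  first exact: countable_omega1_lt.
by move=> b ba; apply: Delta11_splits => u; apply: IH.
Qed.

(** The pairs [(x, y)] such that [y] has a witness [z] whose branch passes
through [t] and stays in the [b]-th derivative of [T x], while [t] does not
split in that derivative.  The last condition makes [y] unique. *)
Definition branch_selector (T : cantor_space -> node -> Prop) (b : omega1)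
    (t : node) : set (cantor_space * cantor_space) :=
  [set p | ~ splits (deriv (T p.1) b) t /\
    exists z, restr p.2 z (size t) = t /\
      forall n, deriv (T p.1) b (restr p.2 z n)].

Lemma restr_ext y z m n : m <= n ->
  exists u, restr y z n = restr y z m ++ u.
Proof.
move=> mn; exists (map (fun i => (y i, z i)) (iota m (n - m))).
by rewrite /restr /mkseq -map_cat -{2}[m]add0n -iotaD subnKC.
Qed.

Lemma branch_selector_fun T b t x y y' :
  branch_selector T b t (x, y) -> branch_selector T b t (x, y') -> y = y'.
Proof.
move=> [/= nosplit [z [tz Dz]]] [_ [z' [tz' Dz']]].
apply: contrapT => yy'; apply: nosplit.
have [i yi] : exists i, y i <> y' i.
  by apply: contrapT => ni; apply: yy'; apply/funext => i;
    apply: contrapT => h; apply: ni; exists i.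
have [u uE] := restr_ext y z (leq_maxl (size t) i.+1).
have [v vE] := restr_ext y' z' (leq_maxl (size t) i.+1).
rewrite tz in uE; rewrite tz' in vE.
exists (u, v); rewrite /= -uE -vE; split; [exact: Dz|exact: Dz'|].
have lt_in : i < maxn (size t) i.+1 by rewrite leq_max leqnn orbT.
by exists i; rewrite !size_mkseq; split => //; rewrite !nth_mkseq.
Qed.

Lemma splits_avoid (K : node -> Prop) t (y : cantor_space) : splits K t ->
  exists u, [/\ K (t ++ u), size t < size (t ++ u) &
    exists2 i, i < size (t ++ u) & (nth (false, 0) (t ++ u) i).1 <> y i].
Proof.
move=> [[u v] [/= Ku Kv [i [iu iv uv]]]].
(* The two extensions agree on t, so they disagree beyond it. *)
have ti : size t <= i.
  by rewrite leqNgt; apply/negP => lt_it; apply: uv; rewrite !nth_cat lt_it.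
have [yu|yu] := pselect ((nth (false, 0) (t ++ u) i).1 = y i).
  exists v; split=> //; first exact: leq_ltn_trans iv.
  by exists i => //; rewrite -yu => /esym.
by exists u; split=> //; [exact: leq_ltn_trans iu|exists i].
Qed.

(** If the root of [T] belongs to a family [K] of nodes, each of which splits
in [K], then [T] has a branch whose first component avoids any given sequence
of points. *)
Lemma splitting_tree_diagonal (T K : node -> Prop)
    (enum : nat -> cantor_space) :
  (forall t n, T t -> T (take n t)) -> (forall t, K t -> T t) ->
  (forall t, K t -> splits K t) -> K [::] ->
  exists y z, (forall n, T (restr y z n)) /\ forall n, y <> enum n.
Proof.
move=> Ttake KT Ksplit K0.
have /choice[u uP] (tn : node * nat) : exists u, K tn.1 ->
    [/\ K (tn.1 ++ u), size tn.1 < size (tn.1 ++ u) &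
    exists2 i, i < size (tn.1 ++ u) &
      (nth (false, 0) (tn.1 ++ u) i).1 <> enum tn.2 i].
  have [/Ksplit/splits_avoid h|nK] := pselect (K tn.1); last by exists [::].
  by have [u uP] := h (enum tn.2); exists u.
(* The n-th extension step leaves the n-th enumerated point. *)
pose t := fix t n := if n is m.+1 then t m ++ u (t m, m) else [::].
have Kt n : K (t n) by elim: n => [//|n /(uP (_, n))[]].
have t_size n : n <= size (t n).
  by elim: n => [//|n IHn]; have [_ + _] := uP (t n, n) (Kt n);
    apply: leq_trans.
have t_prefix m n : m <= n -> exists w, t n = t m ++ w.
  move=> /subnKC <-; elim: (n - m) => [|k [w wE]].
    by exists [::]; rewrite addn0 cats0.
  by rewrite addnS /= wE -catA; eexists.
have t_nth m n i : i < size (t m) -> i < size (t n) ->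
    nth (false, 0) (t m) i = nth (false, 0) (t n) i.
  by move=> im i_n; have [/t_prefix|/ltnW/t_prefix] := leqP m n => -[w wE];
    rewrite wE nth_cat ?im ?i_n.
pose y : cantor_space := fun i => (nth (false, 0) (t i.+1) i).1.
pose z : baire_space := fun i => (nth (false, 0) (t i.+1) i).2.
have yz n i : i < size (t n) -> (y i, z i) = nth (false, 0) (t n) i.
  by move=> i_n; rewrite /y /z -surjective_pairing; apply: t_nth.
exists y, z; split=> n.
  suff -> : restr y z n = take n (t n) by apply: Ttake; exact: KT.
  apply: (@eq_from_nth _ (false, 0)); rewrite size_mkseq.
    by rewrite size_takel.
  by move=> i i_n; rewrite nth_mkseq // nth_take // (yz n) // (leq_trans i_n).
have [_ _ [i i_n ne]] := uP (t n, n) (Kt n); move=> yn; apply: ne.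
by rewrite -[_ ++ _]/(t n.+1) -yz //= yn.
Qed.

(** Take the least stage at which a node of the branch is deleted. *)
Lemma deriv_covers (T : node -> Prop) y z :
  ~ (forall a, deriv T a [::]) -> (forall n, T (restr y z n)) ->
  exists b n, ~ splits (deriv T b) (restr y z n) /\
    forall m, deriv T b (restr y z m).
Proof.
move=> nK Tz.
pose bad a := exists n, ~ deriv T a (restr y z n).
have [a0 a0bad] : exists a, bad a.
  by apply: contrapT => nb; apply: nK => a; apply: contrapT => h; apply: nb;
    exists a, 0.
have [a [[n nDn] amin]] : exists a, bad a /\ forall b, omega1_lt b a -> ~ bad b.
  apply: contrapT => nomin; have := omega1_lt_wf a0.
  move=> acc; elim: acc a0bad => {}a0 _ IH bada.
  by apply: nomin; exists a0; split=> // b /IH.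
(* The reason why the node of length n is deleted at stage a. *)
have [b ba nb] : exists2 b, omega1_lt b a & ~ splits (deriv T b) (restr y z n).
  apply: contrapT => h; apply: nDn; apply/derivE; split=> // b ba.
  by apply: contrapT => ns; apply: h; exists b.
exists b, n; split=> // m; apply: contrapT => nD; apply: (amin b ba).
by exists m.
Qed.

(** * Analytic sets with countable sections *)

Lemma cantor_code_restr n (y y' : cantor_space) (z z' : baire_space) :
  restr y z n = restr y' z' n ->
  cantor_code n y = cantor_code n y' /\ seq_code n z = seq_code n z'.
Proof.
move=> h; split; congr pickle.
  by have := congr1 (map (nat_of_bool \o fst)) h; rewrite -!map_comp.
by have := congr1 (map snd) h; rewrite -!map_comp.
Qed.

Lemma Delta11_restr n u :
  Delta11 [set q : cantor_space * cantor_space * baire_space |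
    restr q.1.2 q.2 n = u].
Proof.
apply: (saturated_Delta11 (n := n) (clopen_codes_prod (clopen_codes_prod
  clopen_codes_cantor clopen_codes_cantor) clopen_codes_baire)).
move=> -[[x y] z] [[x' y'] z'] /=.
move=> /(pcan_inj pickleK)[/(pcan_inj pickleK)[_ /(pcan_inj pickleK) ey]].
move=> /(pcan_inj pickleK) ez <-.
apply: (@eq_from_nth _ (false, 0)); rewrite !size_mkseq // => i lt_in.
rewrite !nth_mkseq //; congr pair.
  have := congr1 (nth 0 ^~ i) ey; rewrite !nth_mkseq //=.
  by case: (y' i); case: (y i).
by have := congr1 (nth 0 ^~ i) ez; rewrite !nth_mkseq.
Qed.

Lemma Sigma11_branch_selector (T : cantor_space -> node -> Prop) b t :
  (forall u, Delta11 [set x | T x u]) -> Sigma11 (branch_selector T b t).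
Proof.
move=> TD; have Db := Delta11_deriv TD b.
pose Q : set (cantor_space * cantor_space * baire_space) :=
  [set q | restr q.1.2 q.2 (size t) = t] `&`
  \bigcap_(n in [set: nat]) \bigcup_(u in [set: node])
   ([set q | restr q.1.2 q.2 n = u] `&`
    (fun q => q.1.1) @^-1` [set x | deriv (T x) b u]).
have QD : Delta11 Q.
  have cx : continuous
      (fun q : cantor_space * cantor_space * baire_space => q.1.1).
    exact: continuous_compose (@continuous_fst _ _) (@continuous_fst _ _).
  apply: Delta11_setI; first exact: Delta11_restr.
  apply: Delta11_bigcap => // n _; apply: Delta11_bigcup => // u _.
  by apply: Delta11_setI; [exact: Delta11_restr|exact: Delta11_preimage].
have -> : branch_selector T b t =
  (fst @^-1` ~` [set x | splits (deriv (T x) b) t]) `&` fst @` Q.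
  apply/seteqP; split=> -[x y].
    move=> [ns [z [tz Dz]]]; split=> //; exists ((x, y), z) => //.
    by split=> // n _; exists (restr y z n) => //; split=> //; exact: Dz.
  move=> [ns [[[x' y'] z] [/= tz Dz] [xx yy]]]; subst x' y'.
  split=> //; exists z; split=> // n.
  by have [u _ [/= <-]] := Dz n I.
apply: Sigma11_setI; last by apply: Sigma11_proj; case: QD.
have [] // : Delta11 (fst @^-1` (~` [set x | splits (deriv (T x) b) t])
   : set (cantor_space * cantor_space)).
apply: Delta11_preimage; first exact: continuous_fst.
by apply: Delta11_setC; exact: Delta11_splits.
Qed.

Lemma countable_enum (S : set cantor_space) : countable S ->
  exists enum : nat -> cantor_space, forall y, S y -> exists n, y = enum n.
Proof.
move=> /countable_injP[c cinj].
have /choice[enum enumP] n : exists y, forall y', S y' -> c y' = n -> y' = y.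
  have [[y [Sy cy]]|ny] := pselect (exists y, S y /\ c y = n).
    by exists y => y' Sy' cy'; apply: cinj; rewrite ?inE ?cy.
  by exists (fun=> false) => y' Sy' cy'; case: ny; exists y'.
by exists enum => y Sy; exists (c y); exact: enumP.
Qed.

Theorem Sigma11_countable_sections (A : set (cantor_space * cantor_space)) :
  Sigma11 A -> (forall x, countable [set y | A (x, y)]) ->
  exists f : omega1 * node -> set (cantor_space * cantor_space),
  [/\ forall i, Sigma11 (f i),
      forall i x y y', f i (x, y) -> f i (x, y') -> y = y' &
      A = \bigcup_i f i].
Proof.
move=> [C [cC ->]] cA.
(* The tree of the section at x, with x replaced by its initial segment of
length size t. *)
pose T (x : cantor_space) (t : node) := exists p z,
  [/\ C (p, z), restr p.2 z (size t) = t &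
    cantor_code (size t) p.1 = cantor_code (size t) x].
have TC x y z : (forall n, T x (restr y z n)) <-> C ((x, y), z).
  split=> [Tyz|Cyz n]; last by exists (x, y), z; rewrite size_mkseq.
  apply: (closed_codesP (clopen_codes_prod (clopen_codes_prod
    clopen_codes_cantor clopen_codes_cantor) clopen_codes_baire) cC) => n.
  have [[x' y'] [z' [Cz' /=]]] := Tyz n.
  rewrite size_mkseq => /cantor_code_restr[ey ez] ex.
  by exists ((x', y'), z') => //=; rewrite ex ey ez.
have TD t : Delta11 [set x | T x t].
  apply: (saturated_Delta11 (n := size t) clopen_codes_cantor) => x y yx.
  by move=> [p [z [Cz tz ex]]]; exists p, z; split=> //; rewrite ex yx.
have Ttake x t n : T x t -> T x (take n t).
  move=> [p [z [Cz tz ex]]]; exists p, z.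
  have le_nt : size (take n t) <= size t by rewrite size_take_min geq_minr.
  split=> //; last first.
    by have [_ _ mono] := clopen_codes_cantor; apply: mono le_nt ex.
  transitivity (take n (restr p.2 z (size t))); last by rewrite tz.
  by rewrite /restr /mkseq -map_take take_iota size_take_min.
exists (fun i => branch_selector T i.1 i.2); split.
- by move=> [b t]; exact: Sigma11_branch_selector.
- by move=> [b t] x y y'; exact: branch_selector_fun.
- apply/seteqP; split=> [_ [[[x y] z] Cz <-]|[x y] [[b t] _ [/= _ [z [_ Dz]]]]].
    have nK : ~ forall a, deriv (T x) a [::].
      move=> K0; have [enum enumP] := countable_enum (cA x).
      have [||||y' [z' [Tyz' ny']]] :=
        @splitting_tree_diagonal (T x)
          (fun t => forall a, deriv (T x) a t) enum.
      - exact: Ttake.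
      - have [a0 _] := omega1_sup (@countable0 omega1).
        by move=> t /(_ a0)/derivE[].
      - exact: deriv_kernel_splits.
      - exact: K0.
      have [|n] := enumP y'; last exact: ny'.
      by exists ((x, y'), z') => //; apply/TC.
    have [b [n [ns Dz]]] := deriv_covers nK (proj2 (TC x y z) Cz).
    exists (b, restr y z n) => //; split=> //=; exists z.
    by rewrite size_mkseq.
  exists ((x, y), z) => //; apply/TC => n; have /derivE[] := Dz n; exact.
Qed.

Theorem lemma3p4 (G : set (cantor_space * cantor_space)) :
  is_graph G -> locally_countable G -> Sigma12 G ->
  exists f : omega1 -> set (cantor_space * cantor_space),
    (forall a : omega1, Delta12 (f a)) /\ generated_by G (range f).
Proof.
move=> [Gsym Girr] Glc GS.
have codes := clopen_codes_prod clopen_codes_cantor clopen_codes_cantor.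
have [B [BS GB]] := Sigma12_union_omega1 codes GS.
have BG a p : B a p -> G p by rewrite GB; exists a.
have cB a x : countable [set y | B a (x, y)].
  have [Vx|nVx] := pselect (vertices G x).
    apply: sub_countable (Glc x Vx); apply: subset_card_le => y /=; exact: BG.
  suff -> : [set y | B a (x, y)] = set0 by exact: countable0.
  by apply/seteqP; split=> // y /BG Gxy; apply: nVx; exists y.
have /choice[g gP] a := Sigma11_countable_sections (BS a) (cB a).
have [h hinj] := omega1_prod_inj (seq (bool * nat)).
(* Values outside the range of h index the empty function. *)
pose f c := [set p | exists a i, h (a, i.1, i.2) = c /\ g a i p].
have fE a i : f (h (a, i.1, i.2)) = g a i.
  apply/seteqP; split=> [p [a' [i' [/hinj[-> e1 e2]]]]|p gp];
    last by exists a, i.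
  by rewrite [i']surjective_pairing [i]surjective_pairing e1 e2.
have fcase c : f c = set0 \/ exists a i, f c = g a i.
  have [[a [i hc]]|nh] := pselect (exists a i, h (a, i.1, i.2) = c).
    by right; exists a, i; rewrite -hc fE.
  by left; apply/seteqP; split=> // p [a [i [hc _]]]; apply: nh; exists a, i.
have gG a i p : g a i p -> G p.
  by move=> gp; apply: (BG a); have [_ _ ->] := gP a; exists i.
exists f; split=> [c|].
  apply: (Sigma11_Delta12 codes); have [->|[a [i ->]]] := fcase c.
    exact: Sigma11_set0.
  by have [] := gP a.
have fG c p : f c p -> G p by have [->|[a [i ->]]] := fcase c => // /gG.
split=> [_ [c _ <-]|x y _ _].
  split=> [x y y'|x y /fG Gxy].
    by have [->|[a [i ->]]] := fcase c => //; have [_ fu _] := gP a; exact: fu.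
  by split; [exists y|exists x; exact: Gsym].
split=> [|[_ [c _ <-] [/fG/Gsym|/fG]]//].
rewrite {1}GB => -[a _]; have [_ _ ->] := gP a => -[i _ gxy].
by exists (f (h (a, i.1, i.2))); [exists (h (a, i.1, i.2))|right; rewrite fE].
Qed.
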